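(* Let $\dim(\mathcal{X})<\infty$. Suppose $\mathcal{T}=(T_1,\ldots,T_d)\in \mathcal{Z}$ and $w_p(\mathcal{T})\neq 0$. Then the following are equivalent. (i) The joint numerical radius norm $w_p(\cdot)$ of $\mathcal{Z}$ is Gateaux differentiable at $\mathcal{T}$. (ii) There exists $(x_0,x_0^* )\in \Pi$ such that $x_0\in E_{\mathcal{X}}$, $x_0^*\in E_{\mathcal{X}^*}$ and $M_{w_p(\mathcal{T})}=\{(\mu x_0,\overline{\mu}x_0^* ):\mu\in \mathbb{F},|\mu|=1\}$. Moreover, in this case, for each $\mathcal{S}=(S_1,\ldots,S_d)\in \mathcal{Z}$, $$G(\mathcal{T},\mathcal{S})=\frac{1}{w_p(\mathcal{T})^{p-1}}\sum_{i=1}^d\Re\Big(\overline{x_0^*(T_ix_0)}|x_0^*(T_ix_0)|^{p-2}x_0^*(S_ix_0)\Big).$$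
   Context: $\mathcal{X}$ is a nonzero Banach space over $\mathbb{F}$ ($\mathbb{R}$ or $\mathbb{C}$) with dual $\mathcal{X}^*$. For a normed space $\mathcal{Y}$, $S_{\mathcal{Y}}$ is its unit sphere and $E_{\mathcal{Y}}$ the set of extreme points of its closed unit ball. $\mathcal{L}(\mathcal{X})$ is the space of bounded linear operators on $\mathcal{X}$; $\Pi=\{(x,x^* ): x\in S_{\mathcal{X}},\ x^*\in S_{\mathcal{X}^*},\ x^*(x)=1\}$. Standing assumption: the numerical radius $w(T)=\sup\{|x^*(Tx)|:(x,x^* )\in\Pi\}$ is a norm on $\mathcal{L}(\mathcal{X})$ (automatic if $\mathbb{F}=\mathbb{C}$). Fix an integer $d\ge 1$ and $1<p<\infty$. The joint numerical radius of $\mathcal{T}=(T_1,\ldots,T_d)\in\mathcal{L}(\mathcal{X})^d$ is $w_p(\mathcal{T})=\sup\{(\sum_{i=1}^d|x^*(T_ix)|^p)^{1/p}:(x,x^* )\in\Pi\}$, and $\mathcal{Z}=(\mathcal{L}(\mathcal{X})^d,w_p(\cdot))$. $M_{w_p(\mathcal{T})}=\{(x,x^* )\in\Pi:(\sum_{i=1}^d|x^*(T_ix)|^p)^{1/p}=w_p(\mathcal{T})\}$. Let $G_{\pm}(\mathcal{T},\mathcal{S})=\lim_{t\to0\pm}\frac{w_p(\mathcal{T}+t\mathcal{S})-w_p(\mathcal{T})}{t}$ ($t$ real). The norm $w_p(\cdot)$ is Gateaux differentiable at $\mathcal{T}$ if $G_+(\mathcal{T},\mathcal{S})=G_-(\mathcal{T},\mathcal{S})$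 for all $\mathcal{S}\in\mathcal{Z}$, and then $G(\mathcal{T},\mathcal{S})$ denotes the common value. Convention: $\overline{a}|a|^{p-2}$ means $0$ when $a=0$. *)

(* Defs.v *)
From HB Require Import structures.
From mathcomp Require Import all_boot all_order all_algebra.
From mathcomp Require Import complex.
From mathcomp Require Import all_classical all_reals all_analysis.

Set Implicit Arguments.
Unset Strict Implicit.
Unset Printing Implicit Defensive.

Import Order.TTheory GRing.Theory Num.Theory.
Import numFieldNormedType.Exports.

Local Open Scope classical_set_scope.
Local Open Scope ring_scope.

(* The scalar field is either a realType R or its complex extension R[i].
   Norms of a normedModType K take values in K; [rnorm] reads them in R. *)
Inductive scalar_kind := RealScalars | ComplexScalars.

Section Scalars.
Context (R : realType).

Definition scalarField (k : scalar_kind) : numFieldType :=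
  match k with
  | RealScalars => R : numFieldType
  | ComplexScalars => R[i] : numFieldType
  end.

Definition rePart {k : scalar_kind} : scalarField k -> R :=
  match k return scalarField k -> R with
  | RealScalars => fun a => a
  | ComplexScalars => fun a => complex.Re a
  end.

Definition conjS {k : scalar_kind} : scalarField k -> scalarField k :=
  match k return scalarField k -> scalarField k with
  | RealScalars => fun a => a
  | ComplexScalars => fun a => conjc a
  end.

Definition ofReal {k : scalar_kind} : R -> scalarField k :=
  match k return R -> scalarField k with
  | RealScalars => fun t => t
  | ComplexScalars => fun t => real_complex R t
  end.

Definition rnorm {k : scalar_kind} {V : normedModType (scalarField k)} (v : V) : R :=
  rePart `|v|.

End Scalars.

Section NormedSpaces.
Context (R : realType) (k : scalar_kind).
Local Notation K := (scalarField R k).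

Definition finite_dimensional (V : lmodType K) : Prop :=
  exists n (e : 'I_n -> V), forall v, exists c : 'I_n -> K,
    v = \sum_(i < n) c i *: e i.

Definition extreme_points (V : lmodType K) (A : set V) : set V :=
  [set x | A x /\ forall (y z : V) (t : R), A y -> A z -> 0 < t < 1 ->
     x = ofReal t *: y + ofReal (1 - t) *: z -> y = x /\ z = x].

Definition norm_on (V : lmodType K) (A : set V) (N : V -> R) : Prop :=
  [/\ forall x, A x -> 0 <= N x,
      forall x, A x -> N x = 0 -> x = 0,
      forall (a : K) x, A x -> N (a *: x) = rnorm (a : K^o) * N x
    & forall x y, A x -> A y -> N (x + y) <= N x + N y].

Definition bounded_linear (V W : normedModType K) : set (V -> W) :=
  [set f | linear f /\ exists M : R, forall x, rnorm (f x) <= M * rnorm x].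

End NormedSpaces.

Arguments bounded_linear {R k} V W.

Section NumericalRadius.
Context (R : realType) (k : scalar_kind) (X : normedModType (scalarField R k)).
Local Notation K := (scalarField R k).

Definition dual_space : set (X -> K^o) := bounded_linear X K^o.

Definition unit_ball : set X := [set x | rnorm x <= 1].

Definition dual_norm (f : X -> K^o) : R :=
  sup [set rnorm (f x) | x in unit_ball].

Definition dual_unit_ball : set (X -> K^o) :=
  [set f | dual_space f /\ dual_norm f <= 1].

Definition norming_pairs : set (X * (X -> K^o)) :=
  [set z | [/\ rnorm z.1 = 1, dual_space z.2, dual_norm z.2 = 1 & z.2 z.1 = 1]].

Definition num_radius (T : X -> X) : R :=
  sup [set rnorm (z.2 (T z.1)) | z in norming_pairs].

Section Joint.
Context (d : nat) (p : R).

Definition operator_tuples : set ('I_d -> X -> X) :=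
  [set T | forall i, bounded_linear X X (T i)].

Definition lp_value (T : 'I_d -> X -> X) (z : X * (X -> K^o)) : R :=
  (\sum_(i < d) rnorm (z.2 (T i z.1)) `^ p) `^ p^-1.

Definition joint_radius (T : 'I_d -> X -> X) : R :=
  sup [set lp_value T z | z in norming_pairs].

Definition attainment_set (T : 'I_d -> X -> X) : set (X * (X -> K^o)) :=
  [set z | norming_pairs z /\ lp_value T z = joint_radius T].

Definition diff_quotient (T S : 'I_d -> X -> X) (t : R) : R :=
  (joint_radius (T + ofReal t *: S) - joint_radius T) / t.

Definition G_plus (T S : 'I_d -> X -> X) : R :=
  lim (diff_quotient T S t @[t --> 0^'+]).

Definition G_minus (T S : 'I_d -> X -> X) : R :=
  lim (diff_quotient T S t @[t --> 0^'-]).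

(* [lim] is total, so existence of both one-sided limits is required. *)
Definition gateaux_differentiable (T : 'I_d -> X -> X) : Prop :=
  forall S, operator_tuples S ->
    [/\ cvg (diff_quotient T S t @[t --> 0^'+]),
        cvg (diff_quotient T S t @[t --> 0^'-])
      & G_plus T S = G_minus T S].

(* Meaningful only when G_plus and G_minus agree. *)
Definition gateaux_derivative (T S : 'I_d -> X -> X) : R := G_plus T S.

Definition unique_attainment (T : 'I_d -> X -> X)
    (x0 : X) (f0 : X -> K^o) : Prop :=
  [/\ norming_pairs (x0, f0),
      extreme_points unit_ball x0,
      extreme_points dual_unit_ball f0
    & attainment_set T =
      [set (mu *: x0, conjS mu *: f0) | mu in [set mu : K | `|mu| = 1]]].

End Joint.
End NumericalRadius.

Arguments num_radius {R k} X T.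

(* Main.v *)
Require Import Defs.
From HB Require Import structures.
From mathcomp Require Import all_boot all_order all_algebra.
From mathcomp Require Import complex.
From mathcomp Require Import all_classical all_reals all_analysis.
From mathcomp Require Import ring lra.

Set Implicit Arguments.
Unset Strict Implicit.
Unset Printing Implicit Defensive.

Import Order.TTheory GRing.Theory Num.Theory.
Import numFieldNormedType.Exports.

Local Open Scope classical_set_scope.
Local Open Scope ring_scope.

(** For a norming pair z = (x, x^* ) write F(T, z) for the p-norm of the family
   x^*(T_i x), so that the joint radius N(T) is the supremum of F(T, z) over the
   norming pairs.  In finite dimension these pairs form a compact set and F is
   continuous, so N is a maximum of the convex functions F(., z), and the
   theorem is a statement about which of them are active at T.

   Uniqueness implies differentiability.  At an active z the function
   t |-> F(T + tS, z) has an explicit derivative at 0, because p > 1 makes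
   t |-> |a + tb|^p differentiable even at a = 0 ([lp_norm_quotient_cvg]).
   This derivative bounds the right derivative of N from below.  Danskin's
   argument gives the reverse bound: pairs far from the active ones are beaten
   by a fixed margin, by compactness, and the others are controlled through
   the monotonicity of difference quotients ([diff_quotient_right_cvg]).  All
   the pairs of an orbit (mu x, conj(mu) x^* ) have the same F, so an active set
   reduced to one orbit gives a single derivative, linear in S; replacing S by
   -S then identifies it with the left derivative.

   Differentiability implies uniqueness.  Each active z contributes a real
   linear minorant of S |-> G_+(T, S), and differentiability forces all of them
   to coincide ([gateaux_gradient]).  Testing them on tuples with a single
   nonzero entry of rank one recovers the tensor x (x) x^*, hence z up to a
   unimodular scalar ([gradient_determines_pair]).

   Extremality costs nothing more.  If x_0 is a proper convex combination of
   y and z in the unit ball, then x_0^*(y) = x_0^*(z) = 1, so (y, x_0^* ) and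
   (z, x_0^* ) are norming pairs; F(T, .) being convex in the vector, both are
   active, so they lie in the orbit of (x_0, x_0^* ), which contains only one
   pair with second component x_0^*.  The same argument applies to x_0^*. *)

(** * Scalar fields and norms *)

Section ScalarFields.
Context {R : realType} {k : scalar_kind}.
Local Notation K := (scalarField R k).
Implicit Types (a b : K) (t : R).

Lemma rePartD a b : rePart (a + b) = rePart a + rePart b.
Proof. by case: k a b => //= -[? ?] [? ?]. Qed.

Lemma rePartN a : rePart (- a) = - rePart a.
Proof. by case: k a => //= -[? ?]. Qed.

Lemma rePart_ofReal t : rePart (ofReal t : K) = t.
Proof. by case: k. Qed.

Lemma ofRealD s t : ofReal (s + t) = ofReal s + ofReal t :> K.
Proof. by case: k => //=; rewrite rmorphD. Qed.

Lemma ofRealN t : ofReal (- t) = - ofReal t :> K.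
Proof. by case: k => //=; rewrite rmorphN. Qed.

Lemma ofRealM s t : ofReal (s * t) = ofReal s * ofReal t :> K.
Proof. by case: k => //=; rewrite rmorphM. Qed.

Lemma ofReal0 : ofReal 0 = 0 :> K.
Proof. by case: k. Qed.

Lemma ofReal1 : ofReal 1 = 1 :> K.
Proof. by case: k. Qed.

Lemma ler_ofReal s t : ((ofReal s : K) <= ofReal t) = (s <= t).
Proof. by case: k => //=; rewrite lecR. Qed.

Lemma ltr_ofReal s t : ((ofReal s : K) < ofReal t) = (s < t).
Proof. by case: k => //=; rewrite ltcR. Qed.

Lemma ofReal_rePart a : 0 <= a -> ofReal (rePart a) = a.
Proof. by case: k a => //= a /ger0_real/RRe_real. Qed.

Lemma rePart_ofRealM t a : rePart (ofReal t * a) = t * rePart a.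
Proof. by case: k a => //= -[x y] /=; rewrite mul0r subr0. Qed.

Lemma conjSM a b : conjS (a * b) = conjS a * conjS b.
Proof. by case: k a b => //= a b; rewrite rmorphM. Qed.

Lemma conjS1 : conjS 1 = 1 :> K.
Proof. by case: k => //=; exact: conjc1. Qed.

Lemma conjSK a : conjS (conjS a) = a.
Proof. by case: k a => //= a; rewrite conjcK. Qed.

Lemma rePart_conjS a : rePart (conjS a) = rePart a.
Proof. by case: k a => //= -[]. Qed.

Lemma normC_mul a : conjS a * a = `|a| ^+ 2.
Proof.
case: k a => /= [a|a]; first by rewrite real_normK ?num_real// expr2.
rewrite -add_Re2_Im2; case: a => x y /=; apply/eqP.
by rewrite eq_complex /=; apply/andP; split; apply/eqP; ring.
Qed.

Lemma ofReal_rnorm {V : normedModType K} (v : V) : ofReal (rnorm v) = `|v|.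
Proof. exact/ofReal_rePart/normr_ge0. Qed.

Lemma rnorm_ge0 {V : normedModType K} (v : V) : 0 <= rnorm v.
Proof. by rewrite -ler_ofReal ofReal_rnorm ofReal0. Qed.

Lemma rnorm0 {V : normedModType K} : rnorm (0 : V) = 0.
Proof. by rewrite /rnorm normr0 -ofReal0 rePart_ofReal. Qed.

Lemma rnorm_eq0 {V : normedModType K} (v : V) : rnorm v = 0 -> v = 0.
Proof. by move=> v0; apply: normr0_eq0; rewrite -ofReal_rnorm v0 ofReal0. Qed.

Lemma rnormD {V : normedModType K} (u v : V) :
  rnorm (u + v) <= rnorm u + rnorm v.
Proof. by rewrite -ler_ofReal ofRealD !ofReal_rnorm ler_normD. Qed.

Lemma rnormN {V : normedModType K} (v : V) : rnorm (- v) = rnorm v.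
Proof. by rewrite /rnorm normrN. Qed.

Lemma rnormB_le {V : normedModType K} (u v : V) :
  `|rnorm u - rnorm v| <= rnorm (u - v).
Proof.
have := rnormD (u - v) v; have := rnormD (v - u) u.
rewrite !subrK -opprB rnormN ler_norml => ? ?; lra.
Qed.

Lemma rnormZ {V : normedModType K} a (v : V) :
  rnorm (a *: v) = rnorm (a : K^o) * rnorm v.
Proof.
rewrite {1}/rnorm normrZ -(ofReal_rnorm v) -(ofReal_rnorm (a : K^o)).
by rewrite -ofRealM rePart_ofReal.
Qed.

Lemma rnormM a b : rnorm (a * b : K^o) = rnorm (a : K^o) * rnorm (b : K^o).
Proof. exact: (rnormZ a (b : K^o)). Qed.

Lemma rnorm_ofReal t : rnorm (ofReal t : K^o) = `|t|.
Proof.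
have norm_pos s : 0 <= s -> rnorm (ofReal s : K^o) = s.
  by move=> s0; rewrite /rnorm ger0_norm ?rePart_ofReal// -ofReal0 ler_ofReal.
have [t0|t0] := leP 0 t; first by rewrite norm_pos ?ger0_norm.
by rewrite -rnormN -ofRealN norm_pos ?ltr0_norm// oppr_ge0 ltW.
Qed.

Lemma rnorm_unit a : `|a| = 1 -> rnorm (a : K^o) = 1.
Proof. by move=> a1; rewrite /rnorm a1 -ofReal1 rePart_ofReal. Qed.

Lemma conjS_mul a : conjS a * a = ofReal (rnorm (a : K^o) ^+ 2).
Proof. by rewrite normC_mul -(ofReal_rnorm (a : K^o)) expr2 -ofRealM. Qed.

Lemma rePart_conjS_mul a : rePart (conjS a * a) = rnorm (a : K^o) ^+ 2.
Proof. by rewrite conjS_mul rePart_ofReal. Qed.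

Lemma conjS_ofReal t : conjS (ofReal t) = ofReal t :> K.
Proof. by case: k => //=; exact: conjc_real. Qed.

Lemma conjSD a b : conjS (a + b) = conjS a + conjS b.
Proof. by case: k a b => //= a b; rewrite rmorphD. Qed.

Lemma rnorm_conjS a : rnorm (conjS a : K^o) = rnorm (a : K^o).
Proof.
apply/eqP; rewrite -(@eqrXn2 _ 2)// ?rnorm_ge0//.
by rewrite -!rePart_conjS_mul conjSK mulrC.
Qed.

Lemma rePart_le_rnorm a : rePart a <= rnorm (a : K^o).
Proof.
rewrite (le_trans (ler_norm _))// -ler_sqr ?nnegrE ?rnorm_ge0//.
rewrite real_normK ?num_real// -rePart_conjS_mul.
case: k a => [a|[x y]] /=; first by rewrite expr2.
by rewrite mulNr opprK expr2 lerDl -expr2 sqr_ge0.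
Qed.

(** For complex scalars the modulus bound leaves no room for an imaginary
   part. *)
Lemma rePart_eq1 a : rePart a = 1 -> rnorm (a : K^o) <= 1 -> a = 1.
Proof.
move=> a1; rewrite -(ler_sqr (rnorm_ge0 _)) ?nnegrE// -rePart_conjS_mul expr1n.
case: k a a1 => [//|[x y]] /= ->.
rewrite mulr1 mulNr opprK gerDl -expr2 => y0.
by move: y0; rewrite real_exprn_even_le0 ?num_real//= => /eqP ->.
Qed.

Lemma rePart_mul_inj a a' :
  (forall b, rePart (a * b) = rePart (a' * b)) -> a = a'.
Proof.
(* The test scalar is b = conj (a - a'). *)
move=> aa'; apply/eqP; rewrite -subr_eq0; apply/eqP.
apply: (@rnorm_eq0 K^o); apply/eqP; rewrite -sqrf_eq0; apply/eqP.
by rewrite -rePart_conjS_mul mulrC mulrBl rePartD rePartN aa' subrr.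
Qed.

(** The modulus itself is not smooth in t, but its square is a polynomial: the
   derivative of |a + t b|^p is computed from here. *)
Lemma rnorm_perturb_sqr a b t :
  rnorm (a + ofReal t * b : K^o) ^+ 2 =
  rnorm (a : K^o) ^+ 2 + t * (2 * rePart (conjS a * b)
    + t * rnorm (b : K^o) ^+ 2).
Proof.
rewrite -!rePart_conjS_mul conjSD conjSM conjS_ofReal.
have -> : (conjS a + ofReal t * conjS b) * (a + ofReal t * b) =
    conjS a * a + ofReal t * (conjS a * b + conjS b * a
      + ofReal t * (conjS b * b)) by ring.
rewrite !(rePartD, rePart_ofRealM).
by rewrite -[rePart (conjS b * a)]rePart_conjS conjSM conjSK [b * _]mulrC; ring.
Qed.

Lemma continuous_rnorm {V : normedModType K} : continuous (@rnorm R k V).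
Proof.
move=> v; apply/cvgrPdist_lt => e e0; near=> w.
rewrite (le_lt_trans (rnormB_le _ _))// -ltr_ofReal ofReal_rnorm.
near: w; apply: cvgr_dist_lt; first exact: cvg_id.
by rewrite -ofReal0 ltr_ofReal.
Unshelve. all: by end_near. Qed.

Lemma continuous_ofReal : continuous (@ofReal R k : R -> K^o).
Proof.
move=> t; apply/cvgrPdist_lt => e e0; near=> s.
rewrite -(ofReal_rePart (ltW e0)) -ofReal_rnorm -ofRealN -ofRealD rnorm_ofReal.
rewrite ltr_ofReal; near: s; apply: cvgr_dist_lt; first exact: cvg_id.
by rewrite -ltr_ofReal ofReal_rePart ?ofReal0// ltW.
Unshelve. all: by end_near. Qed.

Lemma closed_rnorm_le {V : normedModType K} (M : R) :
  closed [set v : V | rnorm v <= M].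
Proof.
apply: (@preimage_closed _ _ (@rnorm R k V) [set t : R | t <= M]).
  by move=> v _; exact: continuous_rnorm.
exact: closed_le.
Qed.

(** A closed part of the image of the square [-M, M]^2 under
   (s, t) |-> s + i t, where i is replaced by 0 for real scalars. *)
Lemma compact_scalar_ball (M : R) : compact [set a : K^o | rnorm a <= M].
Proof.
have [iota cartesian] : exists iota : K, forall a : K, exists s t,
    [/\ a = ofReal s + ofReal t * iota,
    `|s| <= rnorm (a : K^o) & `|t| <= rnorm (a : K^o)].
  have le_norm (x : R) (a : K) :
      x ^+ 2 <= rePart (conjS a * a) -> `|x| <= rnorm (a : K^o).
    rewrite rePart_conjS_mul -real_normK ?num_real// => xa.
    by rewrite -ler_sqr ?nnegrE ?rnorm_ge0.
  case: k le_norm => le_norm.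
    exists 0 => a; exists a, 0; split; first by rewrite /= mulr0 addr0.
      by apply: le_norm; rewrite /= expr2.
    by apply: le_norm; rewrite /= expr0n -expr2 sqr_ge0.
  exists (Complex 0 1) => -[x y]; exists x, y; split.
  - by apply/eqP; rewrite eq_complex/=; apply/andP; split; apply/eqP; ring.
  - by apply: le_norm; rewrite /= mulNr opprK expr2 lerDl -expr2 sqr_ge0.
  - by apply: le_norm; rewrite /= mulNr opprK -!expr2 lerDr sqr_ge0.
pose f (z : R * R) : K^o := ofReal z.1 + ofReal z.2 *: (iota : K^o).
apply: (@subclosed_compact _ _ (f @` (`[- M, M] `*` `[- M, M]))).
- exact: closed_rnorm_le.
- apply: continuous_compact.
    apply: continuous_subspaceT => z; apply: cvgD.
      apply: continuous_comp; [exact: cvg_fst|exact: continuous_ofReal].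
    apply: cvgZr_tmp.
    apply: continuous_comp; [exact: cvg_snd|exact: continuous_ofReal].
  by apply: compact_setX; exact: segment_compact.
- move=> a /= aM; have [s [t [ast sa ta]]] := cartesian a.
  exists (s, t); last by rewrite ast.
  split; rewrite /= in_itv/= -ler_norml.
    exact: le_trans sa aM.
  exact: le_trans ta aM.
Qed.

End ScalarFields.

(** * The p-norm of a finite family *)

HB.lock Definition lp_norm (R : realType) (d : nat) (p : R) (a : 'I_d -> R) : R :=
  (\sum_(i < d) a i `^ p) `^ p^-1.

Section FiniteLpNorm.
Context {R : realType} (d : nat) (p : R).
Hypothesis p_gt1 : 1 < p.
Implicit Types a b : 'I_d -> R.

Local Notation lp_norm := (lp_norm p).

Let p_gt0 : 0 < p. Proof. exact: lt_trans p_gt1. Qed.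

Lemma lp_norm_ge0 a : 0 <= lp_norm a.
Proof. by rewrite unlock; exact: powR_ge0. Qed.

Lemma sum_powR_ge0 a : 0 <= \sum_(i < d) a i `^ p.
Proof. by apply: sumr_ge0 => i _; exact: powR_ge0. Qed.

Lemma powR_lp_norm a : lp_norm a `^ p = \sum_(i < d) a i `^ p.
Proof.
by rewrite unlock -powRrM mulVf ?gt_eqF// powRr1// sum_powR_ge0.
Qed.

Lemma le_lp_norm a b : (forall i, 0 <= a i <= b i) -> lp_norm a <= lp_norm b.
Proof.
rewrite unlock => ab; apply: ge0_ler_powR; rewrite ?invr_ge0 ?(ltW p_gt0)// ?nnegrE ?sum_powR_ge0//.
apply: ler_sum => i _; have /andP[a0 abi] := ab i.
by apply: ge0_ler_powR; rewrite ?nnegrE ?(ltW p_gt0)// (le_trans a0).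
Qed.

Lemma lp_normZ t a : 0 <= t -> (forall i, 0 <= a i) ->
  lp_norm (fun i => t * a i) = t * lp_norm a.
Proof.
move=> t0 a0; rewrite unlock.
under eq_bigr do rewrite powRM//.
rewrite -big_distrr/= powRM ?powR_ge0 ?sum_powR_ge0//.
by rewrite -powRrM mulfV ?gt_eqF// powRr1.
Qed.

Lemma lp_norm_eq0 a : (forall i, 0 <= a i) -> lp_norm a = 0 ->
  forall i, a i = 0.
Proof.
rewrite unlock => a0 /powR_eq0_eq0 /eqP; rewrite psumr_eq0; last by move=> *; exact: powR_ge0.
by move=> /allP + i => /(_ i (mem_index_enum _))/eqP/powR_eq0_eq0.
Qed.

Lemma powR_convex (s x y : R) : 0 <= s <= 1 -> 0 <= x -> 0 <= y ->
  (s * x + (1 - s) * y) `^ p <= s * x `^ p + (1 - s) * y `^ p.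
Proof.
move=> /andP[s0 s1] x0 y0.
pose t : {i01 R} := Itv01 s0 s1.
have xI : x \in (`[0, +oo[%classic : set R) by rewrite inE/= in_itv/= x0.
have yI : y \in (`[0, +oo[%classic : set R) by rewrite inE/= in_itv/= y0.
by have := @convex_powR R p (ltW p_gt1) t x y xI yI; rewrite !convRE.
Qed.

(** A positively homogeneous function whose unit ball is convex is
   subadditive; convexity of the unit ball comes from that of x^p. *)
Lemma lp_normD a b : (forall i, 0 <= a i) -> (forall i, 0 <= b i) ->
  lp_norm (fun i => a i + b i) <= lp_norm a + lp_norm b.
Proof.
move=> a0 b0.
have ab0 i : 0 <= a i + b i by exact: addr_ge0.
have [/(lp_norm_eq0 a0) a_eq0|/eqP a_neq0] := pselect (lp_norm a = 0).
  rewrite -[leLHS]add0r lerD ?lp_norm_ge0//; apply: le_lp_norm => i.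
  by rewrite a_eq0 add0r b0 lexx.
have [/(lp_norm_eq0 b0) b_eq0|/eqP b_neq0] := pselect (lp_norm b = 0).
  rewrite -[leLHS]addr0 lerD ?lp_norm_ge0//; apply: le_lp_norm => i.
  by rewrite b_eq0 addr0 a0 lexx.
set A := lp_norm a in a_neq0 *; set B := lp_norm b in b_neq0 *.
have A0 : 0 < A by rewrite lt_def a_neq0 lp_norm_ge0.
have B0 : 0 < B by rewrite lt_def b_neq0 lp_norm_ge0.
have AB0 : 0 < A + B by exact: addr_gt0.
pose s := A / (A + B).
have s01 : 0 <= s <= 1.
  apply/andP; split; first by rewrite divr_ge0// ltW.
  by rewrite /s ler_pdivrMr// mul1r lerDl ltW.
have sE : 1 - s = B / (A + B) by rewrite /s; field; rewrite gt_eqF.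
pose a' i := A^-1 * a i; pose b' i := B^-1 * b i.
have a'0 i : 0 <= a' i by rewrite mulr_ge0 ?invr_ge0// ltW.
have b'0 i : 0 <= b' i by rewrite mulr_ge0 ?invr_ge0// ltW.
have Sa' : \sum_(i < d) a' i `^ p = 1.
  by rewrite -powR_lp_norm lp_normZ ?invr_ge0 ?(ltW A0)// mulVf// powR1.
have Sb' : \sum_(i < d) b' i `^ p = 1.
  by rewrite -powR_lp_norm lp_normZ ?invr_ge0 ?(ltW B0)// mulVf// powR1.
have -> : (fun i => a i + b i) =
    (fun i => (A + B) * (s * a' i + (1 - s) * b' i)).
  apply/funext => i; rewrite sE /s /a' /b'; field.
  by rewrite a_neq0 b_neq0 gt_eqF.
have c0 i : 0 <= s * a' i + (1 - s) * b' i.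
  by case/andP: s01 => ? ?; rewrite addr_ge0// mulr_ge0// subr_ge0.
rewrite lp_normZ ?(ltW AB0)// -[leRHS]mulr1 ler_pM2l//.
have Sc : \sum_(i < d) (s * a' i + (1 - s) * b' i) `^ p <= 1.
  apply: (@le_trans _ _ (\sum_(i < d) (s * a' i `^ p + (1 - s) * b' i `^ p))).
    by apply: ler_sum => i _; exact: powR_convex.
  by rewrite big_split/= -!big_distrr/= Sa' Sb' !mulr1 addrC subrK.
rewrite unlock [leRHS](_ : 1 = 1 `^ p^-1); last by rewrite powR1.
by apply: ge0_ler_powR; rewrite ?nnegrE ?invr_ge0 ?(ltW p_gt0) ?sum_powR_ge0.
Qed.

End FiniteLpNorm.

(** * One-sided derivatives of the p-norm *)

(** The absolute value is needed for a two-sided limit: at a negative base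
   [powR] takes the value 1. *)
Lemma cvg_norm_powR0 {R : realType} (q : R) : 0 < q ->
  (`|t| `^ q) @[t --> (0 : R)] --> (0 : R).
Proof.
move=> q0; apply/cvgrPdist_lt => e e0; near=> t.
rewrite sub0r normrN ger0_norm ?powR_ge0//.
have -> : e = (e `^ q^-1) `^ q by rewrite -powRrM mulVf ?gt_eqF// powRr1// ltW.
apply: gt0_ltr_powR => //; rewrite ?nnegrE ?powR_ge0//.
rewrite -[t]opprK normrN -sub0r.
near: t; apply: cvgr_dist_lt; first exact: cvg_id.
exact: powR_gt0.
Unshelve. all: by end_near. Qed.

Lemma continuous_norm_powR {R : realType} (q : R) : 0 < q ->
  continuous (fun t : R => `|t| `^ q).
Proof.
move=> q0 t; rewrite /continuous_at; have [->|t0] := eqVneq t 0.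
  by rewrite normr0 powR0 ?gt_eqF//; exact: cvg_norm_powR0.
apply: (@continuous_comp _ _ _ (fun t : R => `|t|) (@powR R ^~ q)).
  exact: norm_continuous.
apply: differentiable_continuous; apply/derivable1_diffP.
by apply: derivable_powR; rewrite in_itv/= andbT normr_gt0.
Qed.

Lemma is_derive_norm_powR0 {R : realType} (p : R) : 1 < p ->
  is_derive (0 : R) 1 (fun t => `|t| `^ p) 0.
Proof.
move=> p1.
have p0 : 0 < p by exact: lt_trans p1.
suff Q : ((fun h : R => h^-1 *: (((fun t => `|t| `^ p) \o shift (0 : R)) (h *: (1 : R))
    - `|0 : R| `^ p)) @ 0^') --> (0 : R).
  by apply: DeriveDef; [apply/cvg_ex; exists 0|apply/cvg_lim].
apply: norm_cvg0.
apply: (@cvg_trans _ ((fun t : R => `|t| `^ (p - 1)) @ 0^')); last first.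
  apply: cvg_within_filter; apply: cvg_norm_powR0; rewrite subr_gt0//.
apply: near_eq_cvg; near=> h.
have h0 : h != 0 by near: h; exact: nbhs_dnbhs_neq.
rewrite /= addr0 normr0 powR0 ?gt_eqF// subr0 normrZ normfV.
rewrite [_ *: _]mulr1 (@ger0_norm _ (_ `^ _)) ?powR_ge0//.
by rewrite -(mulr_powRB1 (normr_ge0 h) p0) mulrA mulVf ?normr_eq0// mul1r.
Unshelve. all: by end_near. Qed.

Lemma is_derive_quadratic {R : realType} (A B C : R) :
  is_derive (0 : R) 1 (cst A + id * (cst B + id * cst C)) B.
Proof.
have dM (f : R -> R) f' : is_derive (0 : R) 1 f f' ->
    is_derive (0 : R) 1 (id * f) (f 0).
  move=> df; apply: is_derive_eq (is_deriveM (is_derive_id _ _) df) _.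
  by rewrite scale0r add0r; exact: mulr1.
have := dM _ _ (is_deriveD (is_derive_cst B _ _)
  (dM _ _ (is_derive_cst C (0 : R) (1 : R)))).
move=> /(is_deriveD (is_derive_cst A (0 : R) (1 : R))) /is_derive_eq; apply.
by rewrite add0r !fctE mul0r addr0.
Qed.

Section PerturbedLpNorm.
Context {R : realType} {k : scalar_kind} (d : nat) (p : R).
Local Notation K := (scalarField R k).
Hypothesis p_gt1 : 1 < p.

(** Away from a = 0 this is the derivative of the (p/2)-th power of the positive
   quadratic |a + t b|^2.  At a = 0 the function is |b|^p |t|^p, which is flat at
   0 because p > 1, and the formula gives 0 because its first factor does. *)
Lemma is_derive_rnorm_powR (a b : K) :
  is_derive (0 : R) 1 (fun t => rnorm (a + ofReal t * b : K^o) `^ p)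
   (p * rePart (conjS a * ofReal (rnorm (a : K^o) `^ (p - 2)) * b)).
Proof.
have [->|a0] := eqVneq a 0.
  have -> : (fun t => rnorm (0 + ofReal t * b : K^o) `^ p) =
      (rnorm (b : K^o) `^ p) \*: (fun t : R => `|t| `^ p).
    apply/funext => t /=; rewrite add0r rnormM rnorm_ofReal powRM ?rnorm_ge0//.
    by rewrite mulrC.
  apply: is_derive_eq; first exact/is_deriveZ/is_derive_norm_powR0.
  suff -> : conjS 0 = 0 :> K by rewrite !mul0r -ofReal0 rePart_ofReal mulr0 scaler0.
  by rewrite -ofReal0 conjS_ofReal.
have n0 : 0 < rnorm (a : K^o).
  rewrite lt_def rnorm_ge0 andbT; apply: contra_neq a0.
  by move=> /(@rnorm_eq0 _ _ K^o).
set n := rnorm (a : K^o) in n0 *.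
set c := rePart (conjS a * b); set m := rnorm (b : K^o) ^+ 2.
have sqE (x : R) : 0 <= x -> x `^ p = (x ^+ 2) `^ (p / 2).
  by move=> x0; rewrite -powR_mulrn// -powRrM mulrCA divff ?mulr1// pnatr_eq0.
have -> : (fun t => rnorm (a + ofReal t * b : K^o) `^ p) =
    (@powR R ^~ (p / 2)) \o (cst (n ^+ 2) + id * (cst (2 * c) + id * cst m)).
  by apply/funext => t; rewrite sqE ?rnorm_ge0// rnorm_perturb_sqr.
have pos : 0 < (cst (n ^+ 2) + id * (cst (2 * c) + id * cst m)) (0 : R).
  by rewrite !fctE/= mul0r addr0 exprn_gt0.
apply: is_derive_eq (is_derive1_comp (is_derive1_powR (p / 2) pos)
  (is_derive_quadratic _ _ _)) _.
rewrite !fctE /= mul0r addr0 [conjS a * ofReal _]mulrC -[ofReal _ * _ * b]mulrA rePart_ofRealM.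
rewrite -/c -(powR_mulrn _ (ltW n0)) -powRrM.
have -> : 2%:R * (p / 2 - 1) = p - 2 by field.
by field.
Qed.

(** The p-th root is differentiable only away from 0, whence N != 0; its chain
   rule factor (1/p) (N^p)^(1/p - 1) cancels p and leaves N^(1 - p). *)
Lemma lp_norm_quotient_cvg (a b : 'I_d -> K) :
  let N := lp_norm p (fun i => rnorm (a i : K^o)) in N != 0 ->
  (lp_norm p (fun i => rnorm (a i + ofReal t * b i : K^o)) - N) / t
    @[t --> (0 : R)^'+] -->
  (N `^ (p - 1))^-1 *
  \sum_(i < d) rePart (conjS (a i) * ofReal (rnorm (a i : K^o) `^ (p - 2)) * b i).
Proof.
move=> N N0; set D := (X in _ --> X).
have p_gt0 : 0 < p by exact: lt_trans p_gt1.
have Ngt0 : 0 < N by rewrite lt_def N0 lp_norm_ge0.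
pose g (i : 'I_d) (t : R) := rnorm (a i + ofReal t * b i : K^o) `^ p.
pose F := (@powR R ^~ p^-1) \o (\sum_(i < d) g i).
have FE t : lp_norm p (fun i => rnorm (a i + ofReal t * b i : K^o)) = F t.
  by rewrite unlock /F /= fct_sumE.
have g0 : (\sum_(i < d) g i) 0 = N `^ p.
  rewrite fct_sumE powR_lp_norm//; apply: eq_bigr => i _.
  by rewrite /g ofReal0 mul0r addr0.
have F0 : F 0 = N.
  by rewrite /F /= g0 -powRrM divff ?gt_eqF// powRr1 ?ltW.
have [dF dFE] : is_derive (0 : R) 1 F D.
  have pos : 0 < (\sum_(i < d) g i) (0 : R) by rewrite g0 powR_gt0.
  apply: is_derive_eq (is_derive1_comp (is_derive1_powR p^-1 pos)
    (is_derive_sum (fun i => is_derive_rnorm_powR (a i) (b i)))) _.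
  rewrite g0 -big_distrr /= mulrA; congr (_ * _).
  rewrite -powRrM mulrBr mulr1 mulfV ?gt_eqF// mulrAC mulVf ?gt_eqF// mul1r.
  by rewrite -powRN opprB.
rewrite -dFE.
have right_dnbhs : (0 : R)^'+ `=>` (0 : R)^'.
  move=> A [e e0 eA]; exists e => // t te t0; apply: eA => //.
  by rewrite gt_eqF.
apply: cvg_trans dF; apply: cvg_trans (cvg_app _ right_dnbhs).
apply: near_eq_cvg; near=> t.
by rewrite FE -F0 /= addr0 [_ *: 1]mulr1 [_ *: _]mulrC.
Unshelve. all: by end_near. Qed.

End PerturbedLpNorm.

(** * Finite-dimensional spaces *)

Section UnbundledLinear.
Context {K : pzRingType} {U V : lmodType K} (f : U -> V).
Hypothesis f_lin : linear f.

Lemma linear_bundle : exists g : {linear U -> V}, f = g.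
Proof.
pose m := GRing.isLinear.Build K U V *:%R f f_lin.
pose g : {linear U -> V} := HB.pack f m.
by exists g.
Qed.

Lemma linear_map0 : f 0 = 0.
Proof. by have [g ->] := linear_bundle; exact: linear0. Qed.

Lemma linear_mapD u v : f (u + v) = f u + f v.
Proof. by have [g ->] := linear_bundle; exact: linearD. Qed.

Lemma linear_mapZ a u : f (a *: u) = a *: f u.
Proof. by have [g ->] := linear_bundle; exact: linearZ. Qed.

Lemma linear_map_sum (I : Type) (r : seq I) (F : I -> U) :
  f (\sum_(i <- r) F i) = \sum_(i <- r) f (F i).
Proof. by have [g ->] := linear_bundle; exact: linear_sum. Qed.

End UnbundledLinear.

Section FiniteDimension.
Context {R : realType} {k : scalar_kind}.
Local Notation K := (scalarField R k).

Definition linear_basis {V : lmodType K} {n} (e : 'I_n -> V)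
    (coord : 'I_n -> V -> K^o) : Prop :=
  [/\ forall i, linear (coord i),
      forall v, v = \sum_(i < n) coord i v *: e i
    & forall c i, coord i (\sum_(j < n) c j *: e j) = c i].

(** A spanning family with the least number of members is free: a nontrivial
   relation would allow one member to be dropped. *)
Lemma finite_dimensional_basis (V : lmodType K) : finite_dimensional V ->
  exists n (e : 'I_n -> V) coord, linear_basis e coord.
Proof.
pose spans n (e : 'I_n -> V) := forall v, exists c : 'I_n -> K,
  v = \sum_(i < n) c i *: e i.
move=> [n0 [e0 e0span]].
have ex : exists n, `[< exists e : 'I_n -> V, spans n e >].
  by exists n0; apply/asboolP; exists e0.
case: (ex_minnP ex) => n /asboolP[e espan] nmin.
have free c : \sum_(i < n) c i *: e i = 0 -> forall i, c i = 0.
  move=> ce0 j; apply: contrapT => /eqP cj0.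
  case: n => [|m] in e espan nmin c ce0 j cj0 *; first by case: j cj0.
  suff : (m.+1 <= m)%N by rewrite ltnn.
  apply: nmin; apply/asboolP; exists (fun i => e (lift j i)) => v.
  have [a ->] := espan v.
  exists (fun i => a (lift j i) - a j * (c j)^-1 * c (lift j i)).
  move: ce0; rewrite !(bigD1_ord j)//= => /eqP; rewrite addr_eq0 => /eqP ce.
  have -> : e j = - (c j)^-1 *: \sum_(i < m) c (lift j i) *: e (lift j i).
    by rewrite scaleNr -scalerN -ce scalerA mulVf// scale1r.
  rewrite scalerA scaler_sumr -big_split/=; apply: eq_bigr => i _.
  by rewrite scalerA -scalerDl addrC mulrN mulNr.
have [coord coordE] := choice espan.
have coord_uniq v c : v = \sum_(i < n) c i *: e i -> forall i, coord v i = c i.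
  move=> vE i; apply/eqP; rewrite -subr_eq0; apply/eqP.
  apply: (free (fun i => coord v i - c i)).
  under eq_bigr do rewrite scalerBl.
  by rewrite sumrB -coordE -vE subrr.
exists n, e, (fun i v => coord v i); split => //.
- move=> i a u v; apply: (coord_uniq _ (fun i => a * coord u i + coord v i)).
  rewrite {1}(coordE u) {1}(coordE v) scaler_sumr -big_split/=.
  by apply: eq_bigr => j _; rewrite scalerDl scalerA.
- by move=> c i; exact: coord_uniq.
Qed.

Lemma rnorm_coord_le n (c : 'rV[K]_n) i : rnorm (c ord0 i : K^o) <= rnorm c.
Proof.
rewrite -(@ler_ofReal R k) !ofReal_rnorm [leRHS]mx_normE -[leLHS]nngE num_le.
exact: (le_bigmax _ _ (ord0, i)).
Qed.

Lemma compact_coord_ball n (M : 'I_n -> R) :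
  compact [set c : 'rV[K]_n | forall i, rnorm (c ord0 i : K^o) <= M i].
Proof.
apply: (@rV_compact K n (fun i => [set a : K^o | rnorm a <= M i])) => i.
exact: compact_scalar_ball.
Qed.

Lemma continuous_lincomb {V : normedModType K} n (e : 'I_n -> V) :
  continuous (fun c : 'rV[K]_n => \sum_(i < n) c ord0 i *: e i).
Proof.
apply: continuous_big => [|i _ c]; first exact: add_continuous.
apply: (@continuous_comp _ _ _ (fun c : 'rV[K]_n => c ord0 i)
  (fun a : K => a *: e i)); first exact: coord_continuous.
exact: (@cvgZr_tmp K V K (nbhs (c ord0 i)) _ id (c ord0 i) (e i) cvg_id).
Qed.

(** On the unit sphere of the coordinate space, which is compact, the norm of
   the linear combination has a positive minimum. *)
Lemma bounded_coord {V : normedModType K} n (e : 'I_n -> V) coord :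
  linear_basis e coord ->
  exists M, forall i v, rnorm (coord i v) <= M * rnorm v.
Proof.
move=> [coord_lin coordE coordK].
pose S := [set c : 'rV[K]_n | rnorm c = 1].
have cS : compact S.
  apply: (@subclosed_compact _ _ _ _ (@compact_coord_ball n (fun=> 1))).
    rewrite (_ : S = @rnorm R k _ @^-1` [set 1]); last by [].
    apply: preimage_closed; last exact: closed_eq.
    by move=> v _; exact: continuous_rnorm.
  by move=> c <- i; exact: rnorm_coord_le.
pose mu (c : 'rV[K]_n) := rnorm (\sum_(i < n) c ord0 i *: e i).
have mu_cont : continuous mu.
  move=> c; apply: (@continuous_comp _ _ _ _ (@rnorm R k V)).
    exact: continuous_lincomb.
  exact: continuous_rnorm.
pose row v : 'rV[K]_n := \row_i coord i v.
have rowE v : v = \sum_(i < n) row v ord0 i *: e i.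
  by rewrite {1}(coordE v); apply: eq_bigr => i _; rewrite mxE.
have normalized v : row v != 0 -> 
    S (ofReal (rnorm (row v))^-1 *: row v) /\
    mu (ofReal (rnorm (row v))^-1 *: row v) = (rnorm (row v))^-1 * rnorm v.
  move=> v0; have r0 : 0 < rnorm (row v).
    by rewrite lt_def rnorm_ge0 andbT; apply: contra_neq v0 => /rnorm_eq0.
  have n0 : `|(rnorm (row v))^-1| = (rnorm (row v))^-1.
    by rewrite ger0_norm// invr_ge0 ltW.
  rewrite /S /mu /= rnormZ rnorm_ofReal n0 mulVf ?gt_eqF//; split=> //.
  under eq_bigr do rewrite mxE -scalerA.
  by rewrite -scaler_sumr rnormZ rnorm_ofReal n0 -rowE.
have [S0|] := pselect (S !=set0); last first.
  move=> S0; exists 0 => i v.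
  have [v0|/normalized[Sv _]] := eqVneq (row v) 0; last first.
    by exfalso; apply: S0; eexists; exact: Sv.
  suff -> : coord i v = 0 by rewrite rnorm0 mul0r.
  by move/rowP/(_ i): v0; rewrite !mxE.
have [c cinS cmin] := compact_EVT_min S0 cS (continuous_subspaceT mu_cont).
have m0 : 0 < mu c.
  rewrite lt_def rnorm_ge0 andbT; apply/eqP => /rnorm_eq0 ce0.
  move: cinS; rewrite inE /S /=.
  suff -> : c = 0 by rewrite rnorm0 => /eqP; rewrite eq_sym oner_eq0.
  apply/rowP => i; rewrite mxE -(coordK (fun i => c ord0 i) i) ce0.
  exact: linear_map0.
exists (mu c)^-1 => i v.
have [v0|v0] := eqVneq (row v) 0.
  have -> : coord i v = 0 by move/rowP/(_ i): v0; rewrite !mxE.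
  by rewrite rnorm0 mulr_ge0 ?invr_ge0 ?rnorm_ge0.
have [Sv muv] := normalized v v0.
have := cmin _ (mem_set Sv); rewrite muv => cv.
have r0 : 0 < rnorm (row v).
  by rewrite lt_def rnorm_ge0 andbT; apply: contra_neq v0 => /rnorm_eq0.
apply: (@le_trans _ _ (rnorm (row v))).
  by have := rnorm_coord_le (row v) i; rewrite mxE.
by rewrite mulrC ler_pdivlMr// -ler_pdivlMl.
Qed.

End FiniteDimension.

(** * Compactness of the norming pairs *)

Section NormingPairs.
Context {R : realType} {k : scalar_kind} {X : normedModType (scalarField R k)}.
Local Notation K := (scalarField R k).
Implicit Types (f : X -> K^o) (x : X).

Lemma dual_norm_has_sup f : dual_space f ->
  has_sup [set rnorm (f x) | x in @unit_ball R k X].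
Proof.
move=> [f_lin [M fM]]; split.
  by exists (rnorm (f 0)), 0 => //; rewrite /unit_ball /= rnorm0.
exists (Num.max M 0) => _ [x x1 <-].
rewrite (le_trans (fM x))// (@le_trans _ _ (Num.max M 0 * rnorm x))//.
  by rewrite ler_wpM2r ?rnorm_ge0// le_max lexx.
by rewrite ler_piMr// le_max lexx orbT.
Qed.

Lemma rnorm_dual_le f x : dual_space f -> rnorm (f x) <= dual_norm f * rnorm x.
Proof.
move=> fD; have f_lin := fD.1.
have [->|x0] := eqVneq x 0; first by rewrite linear_map0// !rnorm0 mulr0.
have r0 : 0 < rnorm x.
  by rewrite lt_def rnorm_ge0 andbT; apply: contra_neq x0 => /rnorm_eq0.
rewrite -ler_pdivrMr// mulrC.
have n0 : `|(rnorm x)^-1| = (rnorm x)^-1 by rewrite ger0_norm// invr_ge0 ltW.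
apply: (sup_upper_bound (dual_norm_has_sup fD)).
exists (ofReal (rnorm x)^-1 *: x); last by rewrite linear_mapZ// rnormZ rnorm_ofReal n0.
by rewrite /unit_ball /= rnormZ rnorm_ofReal n0 mulVf ?gt_eqF.
Qed.

Lemma dual_norm_le f (M : R) : 0 <= M -> (forall x, rnorm (f x) <= M * rnorm x) ->
  dual_norm f <= M.
Proof.
move=> M0 fM; apply: ge_sup; first by exists (rnorm (f 0)), 0 => //; rewrite /unit_ball /= rnorm0.
by move=> _ [x /= x1 <-]; rewrite (le_trans (fM x))// ler_piMr.
Qed.

(** The supremum defining the dual norm disappears: it is at most 1 exactly when
   f is a contraction, and then f x = 1 = |x| makes it equal to 1.  All that
   remains are closed conditions. *)
Lemma norming_pairsP x f : norming_pairs (x, f) <->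
  [/\ rnorm x = 1, linear f, forall y, rnorm (f y) <= rnorm y & f x = 1].
Proof.
split=> [[/= x1 fD f1 fx]|[x1 f_lin f_le fx]].
  split=> // [|y]; first by case: fD.
  by have := rnorm_dual_le y fD; rewrite f1 mul1r.
have fD : dual_space f by split=> //; exists 1 => y; rewrite mul1r.
split=> //=; apply/eqP; rewrite eq_le; apply/andP; split.
  by apply: dual_norm_le => // y; rewrite mul1r.
have := rnorm_dual_le x fD; rewrite x1 fx mulr1; apply: le_trans.
by rewrite -ofReal1 rnorm_ofReal normr1.
Qed.

Lemma operator_tuple_linear d (T : 'I_d -> X -> X) i :
  operator_tuples T -> linear (T i).
Proof. by move=> /(_ i) []. Qed.

Section Compactness.
Context (d : nat) (p : R).
Hypothesis p_gt1 : 1 < p.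
Implicit Types T U : 'I_d -> X -> X.

Lemma lp_valueE T z :
  lp_value p T z = lp_norm p (fun i => rnorm (z.2 (T i z.1))).
Proof. by rewrite unlock. Qed.

Section Parametrization.
Context n (e : 'I_n -> X) (coord : 'I_n -> X -> K^o).
Hypothesis e_basis : linear_basis e coord.

(** A functional is given by its values on the basis, so that x^*(g x) becomes a
   bilinear expression in the coordinates. *)
Definition pair_of_coords (u : 'rV[K]_n * 'rV[K]_n) : X * (X -> K^o) :=
  (\sum_(j < n) u.1 ord0 j *: e j,
   fun y => \sum_(l < n) u.2 ord0 l *: coord l y).

Lemma continuous_pair_of_coords (g : X -> X) : linear g ->
  continuous (fun u => (pair_of_coords u).2 (g (pair_of_coords u).1)).
Proof.
move=> g_lin; have [coord_lin _ _] := e_basis.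
have -> : (fun u => (pair_of_coords u).2 (g (pair_of_coords u).1)) =
    (fun u : 'rV[K]_n * 'rV[K]_n => \sum_(l < n) u.2 ord0 l *:
       (\sum_(j < n) u.1 ord0 j *: (coord l (g (e j)) : K^o))).
  apply/funext => u; apply: eq_bigr => l _; congr (_ *: _).
  rewrite linear_map_sum// linear_map_sum//; apply: eq_bigr => j _.
  by rewrite linear_mapZ// linear_mapZ.
apply: continuous_big => [|l _ u]; first exact: add_continuous.
apply: (@cvgZ K K^o).
  apply: (@continuous_comp _ _ _ snd (fun c : 'rV[K]_n => c ord0 l)).
    exact: cvg_snd.
  exact: coord_continuous.
apply: (@continuous_comp _ _ _ fst
  (fun c : 'rV[K]_n => \sum_(j < n) c ord0 j *: (coord l (g (e j)) : K^o))).
  exact: cvg_fst.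
exact: continuous_lincomb.
Qed.

Lemma continuous_lp_value T : operator_tuples T ->
  continuous (fun u => lp_value p T (pair_of_coords u)).
Proof.
move=> T_in; have p_gt0 : 0 < p by exact: lt_trans p_gt1.
have powE (F : 'rV[K]_n * 'rV[K]_n -> R) (q : R) : 0 < q -> (forall u, 0 <= F u) ->
    continuous F -> continuous (fun u => F u `^ q).
  move=> q0 F0 cF; rewrite (_ : (fun u => _) = fun u => `|F u| `^ q); last first.
    by apply/funext => u; rewrite ger0_norm.
  move=> u; apply: (@continuous_comp _ _ _ F (fun t : R => `|t| `^ q)).
    exact: cF.
  exact: continuous_norm_powR.
apply: (powE); first by rewrite invr_gt0.
  by move=> u; apply: sumr_ge0 => i _; exact: powR_ge0.
apply: continuous_big => [|i _]; first exact: add_continuous.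
apply: powE => // [u|]; first exact: rnorm_ge0.
move=> u; apply: (@continuous_comp _ _ _
  (fun u => (pair_of_coords u).2 (T i (pair_of_coords u).1)) (@rnorm R k K^o)).
  by apply: continuous_pair_of_coords; exact: operator_tuple_linear.
exact: continuous_rnorm.
Qed.

Lemma pair_of_coords_surj x f : linear f ->
  (x, f) = pair_of_coords (\row_j coord j x, \row_l f (e l)).
Proof.
move=> f_lin; have [_ coordE _] := e_basis; congr pair.
  by rewrite {1}(coordE x); apply: eq_bigr => j _; rewrite mxE.
apply/funext => y; rewrite {1}(coordE y) linear_map_sum//.
by apply: eq_bigr => l _; rewrite linear_mapZ// mxE; exact: mulrC.
Qed.

Lemma closed_norming_coords :
  closed [set u | norming_pairs (pair_of_coords u)].
Proof.
have [coord_lin _ _] := e_basis.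
have preimage_le (V : normedModType K) (F : 'rV[K]_n * 'rV[K]_n -> V) (r : R) :
    continuous F -> closed [set u | rnorm (F u) <= r].
  move=> cF; apply: (@preimage_closed _ _ F [set v | rnorm v <= r]).
    by move=> u _; exact: cF.
  exact: closed_rnorm_le.
have pair_lin u : linear (pair_of_coords u).2.
  move=> a y z /=; rewrite scaler_sumr -big_split/=; apply: eq_bigr => l _.
  by rewrite coord_lin scalerDr !scalerA mulrC.
have -> : [set u | norming_pairs (pair_of_coords u)] =
    [set u | rnorm (pair_of_coords u).1 = 1] `&`
    ([set u | (pair_of_coords u).2 (pair_of_coords u).1 = 1] `&`
     \bigcap_(y in [set: X]) [set u | rnorm ((pair_of_coords u).2 y) <= rnorm y]).
  apply/seteqP; split=> u /=; rewrite norming_pairsP.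
    by move=> [x1 _ f_le fx]; split=> //; split=> // y _; exact: f_le.
  by move=> [x1 [fx f_le]]; split=> // [|y]; [exact: pair_lin|exact: f_le].
have cont1 : continuous (fun u => (pair_of_coords u).1).
  move=> u; apply: (@continuous_comp _ _ _ fst
    (fun c : 'rV[K]_n => \sum_(j < n) c ord0 j *: e j)); first exact: cvg_fst.
  exact: continuous_lincomb.
apply: closedI; last apply: closedI.
- apply: (@preimage_closed _ _ (fun u => rnorm (pair_of_coords u).1) [set 1 : R]).
    move=> u _; apply: (@continuous_comp _ _ _
      (fun u => (pair_of_coords u).1) (@rnorm R k X)); first exact: cont1.
    exact: continuous_rnorm.
  exact: closed_eq.
- have -> : [set u | (pair_of_coords u).2 (pair_of_coords u).1 = 1] =
      [set u | rnorm ((pair_of_coords u).2 (pair_of_coords u).1 - 1) <= 0].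
    apply/seteqP; split=> u /=; first by move=> ->; rewrite subrr rnorm0.
    move=> h; apply/eqP; rewrite -subr_eq0; apply/eqP/rnorm_eq0/eqP.
    by rewrite eq_le h rnorm_ge0.
  apply: preimage_le => u; apply: cvgB; last exact: cvg_cst.
  exact: (continuous_pair_of_coords (g := id)).
- apply: closed_bigI => y _; apply: preimage_le => u.
  apply: (@continuous_comp _ _ _ snd
    (fun c : 'rV[K]_n => \sum_(l < n) c ord0 l *: coord l y)); first exact: cvg_snd.
  exact: continuous_lincomb.
Qed.

End Parametrization.

(** The norming pairs are the image of a compact set of coordinates on which
   lp_value is continuous, so maxima exist, also under a closed constraint.
   The constraint is needed to maximize over the pairs at which the tuple U
   gains much over T. *)
Lemma lp_value_max T U (r : R) : finite_dimensional X ->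
  operator_tuples T -> operator_tuples U ->
  let A := [set z | norming_pairs z /\ r <= lp_value p U z - lp_value p T z] in
  A !=set0 ->
  exists z, A z /\ forall z', A z' -> lp_value p T z' <= lp_value p T z.
Proof.
move=> /finite_dimensional_basis[n [e [coord e_basis]]] T_in U_in A.
have [coord_lin _ _] := e_basis.
have [M coordM] := bounded_coord e_basis.
pose B := [set c : 'rV[K]_n | forall i, rnorm (c ord0 i : K^o) <= M] `*`
  [set c : 'rV[K]_n | forall i, rnorm (c ord0 i : K^o) <= rnorm (e i)].
have cB : compact B by apply: compact_setX; exact: compact_coord_ball.
pose C := [set u | norming_pairs (pair_of_coords e coord u)] `&`
  [set u | r <= lp_value p U (pair_of_coords e coord u)
                - lp_value p T (pair_of_coords e coord u)].
have clC : closed C.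
  apply: closedI; first exact: closed_norming_coords.
  apply: (@preimage_closed _ _ (fun u => lp_value p U (pair_of_coords e coord u)
     - lp_value p T (pair_of_coords e coord u)) [set t | r <= t]).
    by move=> u _; apply: cvgB; exact: continuous_lp_value.
  exact: closed_ge.
have lift z : A z -> exists2 u, (B `&` C) u & z = pair_of_coords e coord u.
  move: z => [x f] Axf; have [/norming_pairsP[x1 f_lin f_le fx] _] := Axf.
  exists (\row_j coord j x, \row_l f (e l)); last exact: pair_of_coords_surj.
  split.
    split=> i; rewrite /= mxE; last by [].
    by have := coordM i x; rewrite x1 mulr1.
  by rewrite /C /setI /= -(pair_of_coords_surj e_basis).
move=> [z0 /lift[u0 u0in _]].
have [u uin umax] := @compact_EVT_max _ R
  (fun u => lp_value p T (pair_of_coords e coord u)) (B `&` C) (ex_intro _ u0 u0in)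
  (compact_closedI cB clC)
  (continuous_subspaceT (continuous_lp_value e_basis T_in)).
exists (pair_of_coords e coord u); split.
  by move: uin; rewrite inE => -[_ []].
by move=> z' /lift[u' u'in ->]; apply: umax; rewrite inE.
Qed.

End Compactness.
End NormingPairs.

(** * Directional derivatives of the joint radius *)

Local Opaque lp_value.

Section DirectionalDerivative.
Context {R : realType} {k : scalar_kind} {X : normedModType (scalarField R k)}.
Local Notation K := (scalarField R k).
Context (d : nat) (p : R).
Hypothesis p_gt1 : 1 < p.
Hypothesis X_findim : finite_dimensional X.
Implicit Types (T S U : 'I_d -> X -> X) (z : X * (X -> K^o)).

Lemma tuple_addE T S (t : R) i x :
  (T + ofReal t *: S) i x = T i x + ofReal t *: S i x.
Proof. by []. Qed.

Lemma operator_tuplesDZ T S (t : R) : operator_tuples T -> operator_tuples S ->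
  operator_tuples (T + ofReal t *: S).
Proof.
move=> T_in S_in i; have [T_lin [M TM]] := T_in i.
have [S_lin [L SL]] := S_in i; split.
  move=> a x y; rewrite !tuple_addE T_lin S_lin scalerDr !scalerA mulrC.
  by rewrite scalerDr scalerA addrACA.
exists (M + `|t| * L) => x; rewrite tuple_addE (le_trans (rnormD _ _))//.
by rewrite rnormZ rnorm_ofReal mulrDl -mulrA lerD// ler_wpM2l.
Qed.

Lemma pair_linear z : norming_pairs z -> linear z.2.
Proof. by case: z => x f /norming_pairsP[]. Qed.

Lemma lp_valueDZ T S z (t : R) : norming_pairs z ->
  lp_value p (T + ofReal t *: S) z =
  lp_norm p (fun i => rnorm (z.2 (T i z.1) + ofReal t * z.2 (S i z.1) : K^o)).
Proof.
move=> z_in; have f_lin := pair_linear z_in; rewrite lp_valueE; congr lp_norm.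
by apply/funext => i; rewrite tuple_addE linear_mapD// linear_mapZ.
Qed.

Lemma lp_value_ge0 T z : 0 <= lp_value p T z.
Proof. by rewrite lp_valueE lp_norm_ge0. Qed.

Lemma lp_valueDZ_le T S z (t : R) : norming_pairs z -> 0 <= t ->
  lp_value p (T + ofReal t *: S) z <= lp_value p T z + t * lp_value p S z.
Proof.
move=> z_in t0; rewrite lp_valueDZ// !lp_valueE.
rewrite -lp_normZ//; last by move=> i; exact: rnorm_ge0.
have a0 i : 0 <= rnorm (z.2 (T i z.1)) by exact: rnorm_ge0.
have b0 i : 0 <= t * rnorm (z.2 (S i z.1)) by rewrite mulr_ge0 ?rnorm_ge0.
apply: le_trans (lp_normD p_gt1 a0 b0).
apply: le_lp_norm => // i; rewrite rnorm_ge0/=.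
by rewrite (le_trans (rnormD _ _))// rnormM rnorm_ofReal ger0_norm.
Qed.

(** This is convexity along the line through T: the point T + t S divides the
   segment from T to T + s S in the ratio t / s. *)
Lemma lp_value_convex T S z (s t : R) : norming_pairs z -> 0 < t -> t <= s ->
  lp_value p (T + ofReal t *: S) z - lp_value p T z <=
  t / s * (lp_value p (T + ofReal s *: S) z - lp_value p T z).
Proof.
move=> z_in t0 ts; have s0 : 0 < s by exact: lt_le_trans ts.
have st1 : 0 <= 1 - t / s by rewrite subr_ge0 ler_pdivrMr// mul1r.
have st0 : 0 <= t / s by rewrite divr_ge0// ltW.
have rearrange (A B C r : R) :
    A <= (1 - r) * B + r * C -> A - B <= r * (C - B).
  have -> : (1 - r) * B + r * C = r * (C - B) + B by ring.
  by rewrite lerBlDr.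
apply: rearrange.
rewrite !lp_valueDZ// lp_valueE.
set a := fun i => rnorm (z.2 (T i z.1)).
set b := fun i => rnorm (z.2 (T i z.1) + ofReal s * z.2 (S i z.1) : K^o).
have a0 i : 0 <= a i by exact: rnorm_ge0.
have b0 i : 0 <= b i by exact: rnorm_ge0.
rewrite -!lp_normZ//; have a'0 i : 0 <= (1 - t / s) * a i by rewrite mulr_ge0.
have b'0 i : 0 <= t / s * b i by rewrite mulr_ge0.
apply: le_trans (lp_normD p_gt1 a'0 b'0).
apply: le_lp_norm => // i; rewrite rnorm_ge0/=.
have -> : z.2 (T i z.1) + ofReal t * z.2 (S i z.1) =
    ofReal (1 - t / s) * z.2 (T i z.1) + ofReal (t / s) *
      (z.2 (T i z.1) + ofReal s * z.2 (S i z.1)) :> K^o.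
  rewrite mulrDr mulrA -ofRealM divfK ?gt_eqF// addrA -mulrDl -ofRealD subrK.
  by rewrite ofReal1 mul1r.
by rewrite (le_trans (rnormD _ _))// !rnormM !rnorm_ofReal !ger0_norm.
Qed.

Lemma lp_value_attains_max T : operator_tuples T ->
  @norming_pairs R k X !=set0 -> exists2 z, norming_pairs z &
  forall z', norming_pairs z' -> lp_value p T z' <= lp_value p T z.
Proof.
move=> T_in [z0 z0_in].
have [|z [[z_in _] zmax]] := lp_value_max p_gt1 (r := 0) X_findim T_in T_in.
  by exists z0; split=> //; rewrite subrr.
exists z; first exact: z_in.
by move=> z' z'_in; apply: zmax; split; [exact: z'_in|rewrite subrr].
Qed.

Lemma lp_value_le_radius T z : operator_tuples T -> norming_pairs z ->
  lp_value p T z <= joint_radius p T.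
Proof.
move=> T_in z_in.
have [|z0 z0_in zmax] := lp_value_attains_max T_in; first by exists z.
apply: sup_upper_bound; last by exists z.
split; first by exists (lp_value p T z), z.
by exists (lp_value p T z0) => _ [z' z'_in <-]; exact: zmax.
Qed.

Lemma joint_radius_le T (M : R) : @norming_pairs R k X !=set0 ->
  (forall z, norming_pairs z -> lp_value p T z <= M) -> joint_radius p T <= M.
Proof.
move=> [z0 z0_in] le_M; apply: ge_sup; first by exists (lp_value p T z0), z0.
by move=> _ [z z_in <-]; exact: le_M.
Qed.

Lemma joint_radius_neq0 T : joint_radius p T <> 0 -> @norming_pairs R k X !=set0.
Proof.
move=> T0; apply: contrapT => /set0P/negP; rewrite negbK => /eqP Pi0.
by apply: T0; rewrite /joint_radius Pi0 image_set0 sup0.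
Qed.

Lemma attainment_nonempty T : operator_tuples T ->
  @norming_pairs R k X !=set0 -> attainment_set p T !=set0.
Proof.
move=> T_in Pi0.
have [z z_in zmax] := lp_value_attains_max T_in Pi0.
exists z; split=> //; apply/eqP; rewrite eq_le lp_value_le_radius//=.
exact: joint_radius_le.
Qed.

Local Opaque joint_radius.

(** The derivative at T, in the direction S, of lp_value at a fixed z which
   attains the joint radius. *)
Definition radius_gradient T S z : R :=
  (joint_radius p T `^ (p - 1))^-1 *
   \sum_(i < d) rePart (conjS (z.2 (T i z.1)) *
                        ofReal (rnorm (z.2 (T i z.1)) `^ (p - 2)) *
                        z.2 (S i z.1)).

Lemma lp_value_quotient_cvg T S z : joint_radius p T <> 0 ->
  attainment_set p T z ->
  (lp_value p (T + ofReal t *: S) z - joint_radius p T) / t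
     @[t --> (0 : R)^'+] --> radius_gradient T S z.
Proof.
move=> T0 [z_in zE]; have /eqP := T0; rewrite -zE lp_valueE => N0.
have := @lp_norm_quotient_cvg R k d p p_gt1
  (fun i => z.2 (T i z.1)) (fun i => z.2 (S i z.1)) N0.
rewrite /radius_gradient -zE lp_valueE.
by under [in X in _ -> X]eq_fun do rewrite lp_valueDZ//.
Qed.

Lemma radius_gradientN T S z : norming_pairs z ->
  radius_gradient T (- S) z = - radius_gradient T S z.
Proof.
move=> z_in; rewrite /radius_gradient -mulrN -sumrN; congr (_ * _).
apply: eq_bigr => i _.
have -> : z.2 ((- S) i z.1) = - z.2 (S i z.1).
  have [g gE] := linear_bundle (pair_linear z_in).
  by rewrite gE -linearN.
by rewrite mulrN rePartN.
Qed.

Lemma diff_quotientN T S (t : R) :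
  diff_quotient p T S (- t) = - diff_quotient p T (- S) t.
Proof.
have e : T + ofReal (- t) *: S = T + ofReal t *: (- S).
  by rewrite ofRealN scaleNr scalerN.
by rewrite /diff_quotient e invrN mulrN.
Qed.

(** The reflection t |-> - t reduces left limits to right limits. *)
Lemma diff_quotient_left T S (l : R) :
  diff_quotient p T S t @[t --> (0 : R)^'-] --> l <->
  diff_quotient p T (- S) t @[t --> (0 : R)^'+] --> - l.
Proof.
rewrite cvg_at_leftNP oppr0.
have -> : diff_quotient p T S \o -%R = - diff_quotient p T (- S).
  by apply/funext => t /=; rewrite diff_quotientN.
split=> [|dl]; first by move=> /cvgN; rewrite opprK.
by rewrite -[l]opprK; exact: cvgN.
Qed.

Lemma diff_quotient_ge T S z (t : R) : operator_tuples T -> operator_tuples S ->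
  norming_pairs z -> 0 < t ->
  (lp_value p (T + ofReal t *: S) z - joint_radius p T) / t <=
  diff_quotient p T S t.
Proof.
move=> T_in S_in z_in t0; rewrite ler_pM2r ?invr_gt0// lerD2r.
by apply: lp_value_le_radius => //; exact: operator_tuplesDZ.
Qed.

(** Danskin's argument.  If all maximizers of lp_value T give the same value to
   every tuple, then norming pairs at which the quotient with step s is too
   large form a compact set on which lp_value T stays below its maximum by
   some eta > 0; for small t these pairs cannot compete, and for the others
   convexity transfers the bound from step s to step t. *)
Lemma diff_quotient_right_cvg T S z0 : joint_radius p T <> 0 ->
  operator_tuples T -> operator_tuples S -> attainment_set p T z0 ->
  (forall z U, attainment_set p T z -> operator_tuples U ->
    lp_value p U z = lp_value p U z0) ->
  diff_quotient p T S t @[t --> (0 : R)^'+] --> radius_gradient T S z0.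
Proof.
move=> T0 T_in S_in z0max same.
have [z0_in z0E] := z0max.
have q_cvg := lp_value_quotient_cvg (S := S) T0 z0max.
set N := joint_radius p T in z0E q_cvg *; set D := radius_gradient T S z0.
apply/cvgrPdist_le => e e0.
have [s [s0 qs]] : exists s : R, 0 < s /\
    lp_value p (T + ofReal s *: S) z0 - N < s * (D + e).
  have : \forall s \near (0 : R)^'+, 0 < s /\
    (lp_value p (T + ofReal s *: S) z0 - N) / s < D + e.
    near=> s; split; first by near: s; exact: nbhs_right_gt.
    by near: s; apply: (cvgr_lt _ q_cvg); rewrite ltrDl.
  by move=> /filter_ex[s [s0 qs]]; exists s; split=> //; rewrite mulrC -ltr_pdivrMr.
(* Convexity transfers a bound at step s to smaller steps, so A contains all
   the pairs that could violate the bound D + e. *)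
pose A := [set z | norming_pairs z /\
  s * (D + e) <= lp_value p (T + ofReal s *: S) z - lp_value p T z].
have sS_in := operator_tuplesDZ s T_in S_in.
have [eta [eta0 A_eta]] : exists eta : R, 0 < eta /\
    forall z, A z -> lp_value p T z <= N - eta.
  have [A0|A0] := pselect (A !=set0); last first.
    by exists 1; split=> // z Az; exfalso; apply: A0; exists z.
  have [z1 [[z1_in z1A] z1max]] := lp_value_max p_gt1 X_findim T_in sS_in A0.
  exists (N - lp_value p T z1); split; last first.
    by move=> z Az; rewrite subKr; exact: z1max.
  rewrite subr_gt0 lt_neqAle; apply/andP; split; last exact: lp_value_le_radius.
  apply/eqP => z1E; have z1M : attainment_set p T z1 by split.
  by move: z1A; rewrite z1E (same z1 _ z1M sS_in) leNgt qs.
(* On A the value at T + t S is at most N - eta + t N(S), which is below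
   N + t (D + e) as soon as t L <= eta. *)
set L := joint_radius p S - (D + e).
have L0 : 0 < `|L| + 1 by rewrite ltr_wpDl.
near=> t.
have t0 : 0 < t by near: t; exact: nbhs_right_gt.
have ts : t <= s by apply: ltW; near: t; exact: nbhs_right_lt.
have tL : t * L <= eta.
  have tL1 : t * (`|L| + 1) < eta.
    rewrite -ltr_pdivlMr//; near: t; apply: nbhs_right_lt.
    exact: divr_gt0.
  apply: le_trans (ltW tL1); rewrite ler_pM2l//.
  by rewrite (le_trans (ler_norm L))// lerDl.
rewrite ler_distlC; apply/andP; split.
  apply: le_trans (diff_quotient_ge T_in S_in z0_in t0).
  by near: t; apply: (cvgr_ge _ q_cvg); rewrite gtrDl oppr_lt0.
rewrite /diff_quotient ler_pdivrMr// lerBlDr.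
apply: joint_radius_le; first by exists z0.
move=> z z_in; have [Az|nAz] := pselect (A z).
  apply: le_trans (lp_valueDZ_le T S z_in (ltW t0)) _.
  have h1 := A_eta z Az.
  have h2 : t * lp_value p S z <= t * joint_radius p S.
    by rewrite ler_pM2l//; exact: lp_value_le_radius.
  apply: le_trans (lerD h1 h2) _.
  have rearrange (n x y w : R) : y - w <= x -> n - x + y <= w + n.
    by rewrite -addrA [w + n]addrC lerD2l [- x + y]addrC lerBlDr lerBlDl.
  by apply: rearrange; rewrite [(D + e) * t]mulrC -mulrBr.
have lt_s : lp_value p (T + ofReal s *: S) z - lp_value p T z <= s * (D + e).
  by rewrite leNgt; apply/negP => /ltW h; apply: nAz; split.
rewrite -[leLHS](subrK (lp_value p T z)); apply: lerD; last first.
  exact: lp_value_le_radius.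
apply: le_trans (lp_value_convex T S z_in t0 ts) _.
apply: le_trans (ler_wpM2l _ lt_s) _; first by rewrite divr_ge0// ltW.
by rewrite mulrA divfK ?gt_eqF// mulrC.
Unshelve. all: by end_near. Qed.

End DirectionalDerivative.

(** * Pairs attaining the joint radius *)

Section Attainment.
Context {R : realType} {k : scalar_kind} {X : normedModType (scalarField R k)}.
Local Notation K := (scalarField R k).
Context (d : nat) (p : R).
Hypothesis p_gt1 : 1 < p.
Hypothesis X_findim : finite_dimensional X.
Implicit Types (T S U : 'I_d -> X -> X) (z : X * (X -> K^o)).

Lemma conjS_unit (mu : K) : `|mu| = 1 -> conjS mu * mu = 1.
Proof. by move=> mu1; rewrite conjS_mul rnorm_unit// expr1n ofReal1. Qed.

Lemma norming_pair_rotate x (f : X -> K^o) (mu : K) : `|mu| = 1 ->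
  norming_pairs (x, f) -> norming_pairs (mu *: x, conjS mu *: f).
Proof.
move=> mu1 /norming_pairsP[x1 f_lin f_le fx]; apply/norming_pairsP.
have mu1' := rnorm_unit mu1; split.
- by rewrite rnormZ mu1' mul1r.
- move=> a y y'; rewrite !fctE f_lin scalerDr !scalerA.
  by rewrite [conjS mu * a]mulrC.
- by move=> y; rewrite fctE rnormZ rnorm_conjS mu1' mul1r.
- by rewrite fctE linear_mapZ// fx scalerA conjS_unit// scale1r.
Qed.

Lemma lp_value_rotate U x (f : X -> K^o) (mu : K) : operator_tuples U ->
  `|mu| = 1 -> linear f ->
  lp_value p U (mu *: x, conjS mu *: f) = lp_value p U (x, f).
Proof.
move=> U_in mu1 f_lin; rewrite !lp_valueE; congr lp_norm.
apply/funext => i /=; rewrite fctE linear_mapZ; last exact: operator_tuple_linear.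
by rewrite linear_mapZ// scalerA conjS_unit// scale1r.
Qed.

Lemma unique_attainment_derivative T S x0 (f0 : X -> K^o) :
  joint_radius p T <> 0 -> operator_tuples T -> operator_tuples S ->
  unique_attainment p T x0 f0 ->
  diff_quotient p T S t @[t --> (0 : R)^'+] --> radius_gradient p T S (x0, f0).
Proof.
move=> T0 T_in S_in [z0_in _ _ ME].
have z0max : attainment_set p T (x0, f0).
  by rewrite ME; exists 1; rewrite /= ?normr1// conjS1 !scale1r.
apply: (diff_quotient_right_cvg p_gt1 X_findim T0 T_in S_in z0max) => z U.
rewrite ME => -[mu mu1 <-] U_in.
have f0_lin : linear f0 := pair_linear z0_in.
exact: (lp_value_rotate x0 U_in mu1 f0_lin).
Qed.

Lemma operator_tuplesN S : operator_tuples S -> operator_tuples (- S).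
Proof.
move=> S_in i; have [S_lin [M SM]] := S_in i; split.
  by move=> a x y; rewrite !fctE S_lin opprD scalerN.
by exists M => x; rewrite fctE rnormN.
Qed.

(** A maximizer z bounds the radius from below along every direction, so its
   linear gradient lies between the two one-sided derivatives. *)
Lemma gateaux_gradient T S z : joint_radius p T <> 0 ->
  operator_tuples T -> operator_tuples S -> gateaux_differentiable p T ->
  attainment_set p T z -> radius_gradient p T S z = G_plus p T S.
Proof.
move=> T0 T_in S_in gd zM; have [z_in _] := zM.
have below U : operator_tuples U -> radius_gradient p T U z <= G_plus p T U.
  move=> U_in; have [cvgU _ _] := gd U U_in.
  apply: ler_cvg_to (lp_value_quotient_cvg p_gt1 T0 zM) cvgU _.
  apply: filterS (nbhs_right_gt (0 : R)) => t t0.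
  exact: diff_quotient_ge.
have [cvg_right cvg_left GE] := gd S S_in.
have SN_in := operator_tuplesN S_in.
apply/eqP; rewrite eq_le below//= GE.
have /diff_quotient_left dqN : diff_quotient p T S t @[t --> (0 : R)^'-]
    --> G_minus p T S by exact: cvg_left.
have := below _ SN_in; rewrite radius_gradientN//.
have -> : G_plus p T (- S) = - G_minus p T S by exact: cvg_lim dqN.
by rewrite lerN2.
Qed.

(** Rank one tuples concentrated at an index with x^*(T_i x) <> 0 read off the
   tensor x (x) x^*, hence the pair up to a unimodular factor. *)
Lemma gradient_determines_pair T z z' : joint_radius p T <> 0 ->
  attainment_set p T z -> attainment_set p T z' ->
  (forall S, operator_tuples S ->
     radius_gradient p T S z = radius_gradient p T S z') ->
  exists mu : K, `|mu| = 1 /\ z = (mu *: z'.1, conjS mu *: z'.2).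
Proof.
have [n [e [coord e_basis]]] := finite_dimensional_basis X_findim.
have [coord_lin coordE _] := e_basis.
have [M coordM] := bounded_coord e_basis.
move: z z' => [x f] [x' f'] T0 [z_in zE] [z'_in _] grad.
have [x1 f_lin f_le fx] := (norming_pairsP x f).1 z_in.
have [x'1 f'_lin f'_le f'x'] := (norming_pairsP x' f').1 z'_in.
pose w (z : X * (X -> K^o)) i : K := conjS (z.2 (T i z.1)) *
  ofReal (rnorm (z.2 (T i z.1)) `^ (p - 2)).
have [i0 wi0] : exists i, w (x, f) i != 0.
  apply: contrapT => w0; apply: T0; rewrite -zE lp_valueE.
  have T0 i : rnorm (f (T i x)) = 0.
    apply: contrapT => /eqP Ti0; apply: w0; exists i.
    have Ti_gt0 : 0 < rnorm (f (T i x)) by rewrite lt_def Ti0 rnorm_ge0.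
    rewrite /w mulf_neq0//=.
      apply: contraNneq Ti0 => cf0.
      by rewrite -rnorm_conjS cf0 rnorm0.
    apply/eqP => s0; have := powR_gt0 (p - 2) Ti_gt0.
    by rewrite -(@ltr_ofReal R k) s0 ofReal0 ltxx.
  apply/eqP; rewrite eq_le lp_norm_ge0 andbT.
  have -> : 0 = lp_norm p (fun i => 0 * rnorm (f (T i x))) :> R.
    by rewrite lp_normZ// ?mul0r// => i; exact: rnorm_ge0.
  by apply: le_lp_norm => // i; rewrite /= T0 mulr0 lexx.
(* The tuple with the single entry y |-> (b coord_j y) v at i0; letting b vary
   removes the real part from the equality of gradients. *)
have rank1 v j : w (x, f) i0 * (f v * coord j x) =
                 w (x', f') i0 * (f' v * coord j x').
  apply: rePart_mul_inj => b.
  pose S (i : 'I_d) : X -> X :=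
    if i == i0 then fun y => (b * coord j y) *: v else fun=> 0.
  have S_in : operator_tuples S.
    move=> i; rewrite /S; case: ifP => _; split.
    - move=> a y y'; rewrite coord_lin mulrDr scalerDl scalerA.
      by rewrite mulrCA.
    - exists (rnorm (b : K^o) * M * rnorm v) => y.
      rewrite rnormZ rnormM -!mulrA ler_wpM2l ?rnorm_ge0//.
      by rewrite [rnorm v * _]mulrC mulrA ler_wpM2r ?rnorm_ge0.
    - by move=> a y y'; rewrite scaler0 addr0.
    - by exists 0 => y; rewrite rnorm0 mul0r.
  have gradE (g : X -> K^o) y : linear g -> radius_gradient p T S (y, g) =
      (joint_radius p T `^ (p - 1))^-1 *
      rePart (w (y, g) i0 * (g v * coord j y) * b).
    move=> g_lin; rewrite /radius_gradient (bigD1 i0)//= big1 ?addr0.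
      rewrite /S eqxx (linear_mapZ g_lin) -[X in _ = _ * rePart X]mulrA.
      congr (_ * rePart (_ * _)).
      by rewrite [LHS]mulrC [b * _]mulrC mulrA.
    move=> i /negbTE ii0; rewrite /S ii0 (linear_map0 g_lin) mulr0.
    by rewrite -(@ofReal0 R k) rePart_ofReal.
  have N0 : (joint_radius p T `^ (p - 1))^-1 != 0.
    rewrite invr_eq0 gt_eqF// powR_gt0// lt_def; apply/andP; split.
      by apply/eqP.
    by rewrite -zE lp_value_ge0.
  by apply: (mulfI N0); rewrite -!gradE//; exact: grad.
have f'x'j : exists j, coord j x' != 0.
  apply: contrapT => c0; move/eqP: x'1; rewrite (coordE x') big1 ?rnorm0.
    by rewrite eq_sym oner_eq0.
  move=> j _; suff -> : coord j x' = 0 by rewrite scale0r.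
  by apply: contrapT => /eqP cj; apply: c0; exists j.
(* Taking v = x in rank1 gives coord_j x = mu coord_j x' for all j. *)
pose mu : K := w (x', f') i0 * f' x / w (x, f) i0.
have xE : x = mu *: x'.
  rewrite (coordE x) [X in _ *: X](coordE x') scaler_sumr.
  apply: eq_bigr => j _; rewrite scalerA; congr (_ *: _).
  apply: (mulfI wi0); have := rank1 x j; rewrite fx mul1r => ->.
  by rewrite [RHS]mulrA /mu [w (x, f) i0 * _]mulrC divfK// mulrA.
have mu1 : rnorm (mu : K^o) = 1.
  by rewrite -x1 xE rnormZ x'1 mulr1.
have mu1' : `|mu| = 1 by rewrite -(ofReal_rnorm (mu : K^o)) mu1 ofReal1.
exists mu; split=> //; congr pair; first exact: xE.
have mu_neq0 : mu != 0.
  by apply/eqP => mu0; move: mu1; rewrite mu0 rnorm0 => /eqP; rewrite eq_sym oner_eq0.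
(* The two weights agree, because f' x = mu by x = mu x'. *)
have f'x : f' x = mu by rewrite xE linear_mapZ// f'x'; exact: mulr1.
have wE : w (x', f') i0 = w (x, f) i0.
  apply: (mulIf mu_neq0); rewrite [RHS]mulrC -[in LHS]f'x.
  by rewrite /mu divfK.
apply/funext => v; rewrite fctE; have [j cj] := f'x'j.
have : f v * mu = f' v.
  have cE : coord j x = mu * coord j x' by rewrite {1}xE (linear_mapZ (coord_lin j)).
  by have := rank1 v j; rewrite wE cE => /(mulfI wi0); rewrite mulrA => /(mulIf cj).
move=> fv; have -> : f v = conjS mu * (f v * mu).
  by rewrite [f v * mu]mulrC mulrA conjS_unit// mul1r.
by rewrite fv.
Qed.

(** The real parts are at most 1 and average to 1, so both equal 1. *)
Lemma convex_comb_eq1 (a b : K^o) (t : R) : 0 < t < 1 ->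
  rnorm a <= 1 -> rnorm b <= 1 ->
  ofReal t * a + ofReal (1 - t) * b = 1 -> a = 1 /\ b = 1.
Proof.
move=> /andP[t0 t1] a1 b1 ab1.
have ra : rePart a <= 1 by exact: le_trans (rePart_le_rnorm _) a1.
have rb : rePart b <= 1 by exact: le_trans (rePart_le_rnorm _) b1.
have rab : t * rePart a + (1 - t) * rePart b = 1.
  by rewrite -!rePart_ofRealM -rePartD ab1 -(@ofReal1 R k) rePart_ofReal.
have s0 : 0 < 1 - t by rewrite subr_gt0.
split; apply: rePart_eq1 => //; apply/eqP; rewrite eq_le ?ra ?rb/=; nra.
Qed.

Lemma lp_value_comb_le T z z1 z2 (t : R) : 0 < t < 1 ->
  (forall i, z.2 (T i z.1) =
     ofReal t * z1.2 (T i z1.1) + ofReal (1 - t) * z2.2 (T i z2.1)) ->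
  lp_value p T z <= t * lp_value p T z1 + (1 - t) * lp_value p T z2.
Proof.
move=> /andP[/ltW t0 /ltW t1] zE; rewrite !lp_valueE.
have s0 : 0 <= 1 - t by rewrite subr_ge0.
rewrite -!lp_normZ//; last 2 first.
- by move=> i; exact: rnorm_ge0.
- by move=> i; exact: rnorm_ge0.
have a0 i : 0 <= t * rnorm (z1.2 (T i z1.1)) by rewrite mulr_ge0 ?rnorm_ge0.
have b0 i : 0 <= (1 - t) * rnorm (z2.2 (T i z2.1)).
  by rewrite mulr_ge0 ?rnorm_ge0.
apply: le_trans (lp_normD p_gt1 a0 b0); apply: le_lp_norm => // i.
rewrite rnorm_ge0/= zE (le_trans (rnormD _ _))// !rnormM !rnorm_ofReal.
by rewrite !ger0_norm.
Qed.

(** A maximum attained inside a segment along which the value is convex is also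
   attained at both ends. *)
Lemma attainment_comb T z z1 z2 (t : R) : 0 < t < 1 -> operator_tuples T ->
  attainment_set p T z -> norming_pairs z1 -> norming_pairs z2 ->
  (forall i, z.2 (T i z.1) =
     ofReal t * z1.2 (T i z1.1) + ofReal (1 - t) * z2.2 (T i z2.1)) ->
  attainment_set p T z1 /\ attainment_set p T z2.
Proof.
move=> t01 T_in [_ zN] z1_in z2_in zE.
have := lp_value_comb_le t01 zE; rewrite zN.
have le1 := lp_value_le_radius p_gt1 X_findim T_in z1_in.
have le2 := lp_value_le_radius p_gt1 X_findim T_in z2_in.
have squeeze (A B N : R) : A <= N -> B <= N -> N <= t * A + (1 - t) * B ->
    A = N /\ B = N.
  clear -t01; case/andP: t01 => t0 t1 AN BN NAB; have s0 : 0 < 1 - t by lra.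
  by split; apply/eqP; rewrite eq_le ?AN ?BN/=; nra.
by move=> /(squeeze _ _ _ le1 le2)[e1 e2]; split; split.
Qed.

(** An orbit contains a single pair with a given component, since f0 x0 = 1
   detects the scalar mu in either component. *)
Lemma orbit_fixed x0 (f0 : X -> K^o) y (g : X -> K^o) (mu : K) :
  f0 x0 = 1 -> linear f0 -> (mu *: x0, conjS mu *: f0) = (y, g) -> `|mu| = 1 ->
  y = x0 \/ g = f0 -> y = x0 /\ g = f0.
Proof.
move=> f0x0 f0_lin [<- <-] mu1 fixed.
suff -> : mu = 1 by rewrite conjS1 !scale1r.
have muE : mu *: x0 = x0 -> mu = 1.
  by move=> /(congr1 f0); rewrite linear_mapZ// f0x0 => h; rewrite -[LHS]mulr1.
case: fixed => [/muE//|/(congr1 (fun h : X -> K^o => h x0))].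
rewrite fctE f0x0 => cmu1; have c1 : conjS mu = 1 by rewrite -[LHS]mulr1.
by rewrite -[mu]conjSK c1 conjS1.
Qed.

Section UniqueOrbit.
Context (T : 'I_d -> X -> X) (x0 : X) (f0 : X -> K^o).
Hypothesis T_in : operator_tuples T.
Hypothesis z0max : attainment_set p T (x0, f0).
Hypothesis orbit : forall z, attainment_set p T z ->
  exists mu : K, `|mu| = 1 /\ z = (mu *: x0, conjS mu *: f0).

Let z0P := (norming_pairsP x0 f0).1 z0max.1.

(** The end points y and z of a segment through x0 in the ball are normed by f0,
   so (y, f0) and (z, f0) also attain the radius and lie in the orbit. *)
Lemma orbit_extreme_point : extreme_points (@unit_ball R k X) x0.
Proof.
have [x01 f0_lin f0_le f0x0] := z0P.
split=> [|y z t y1 z1 t01 x0E]; first by rewrite /unit_ball /= x01.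
have f0E : ofReal t * f0 y + ofReal (1 - t) * f0 z = 1.
  by rewrite -[RHS]f0x0 [in RHS]x0E (linear_mapD f0_lin) !(linear_mapZ f0_lin).
have [f0y f0z] := convex_comb_eq1 t01 (le_trans (f0_le y) y1)
  (le_trans (f0_le z) z1) f0E.
have pairs u : rnorm u <= 1 -> f0 u = 1 -> norming_pairs (u, f0).
  move=> u1 f0u; apply/norming_pairsP; split=> //; apply/eqP.
  rewrite eq_le u1/=; have := f0_le u; rewrite f0u; apply: le_trans.
  by rewrite -(@ofReal1 R k) rnorm_ofReal normr1.
have T_lin i := operator_tuple_linear i T_in.
have [|yM zM] := attainment_comb t01 T_in z0max (pairs y y1 f0y) (pairs z z1 f0z).
  move=> i /=; rewrite {1}x0E (linear_mapD (T_lin i)) !(linear_mapZ (T_lin i)).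
  by rewrite (linear_mapD f0_lin) !(linear_mapZ f0_lin).
have eq_x0 u : attainment_set p T (u, f0) -> u = x0.
  move=> /orbit[mu [mu1 /esym uE]].
  by have [] := orbit_fixed f0x0 f0_lin uE mu1 (or_intror erefl).
by split; exact: eq_x0.
Qed.

(** The roles of point and functional are exchanged: x0 is normed by both end
   points of a segment through f0 in the dual ball. *)
Lemma orbit_extreme_functional : extreme_points (@dual_unit_ball R k X) f0.
Proof.
have [x01 f0_lin f0_le f0x0] := z0P; have [[_ f0D f01 _] _] := z0max.
split=> [|g h t [gD g1] [hD h1] t01 f0E]; first by split; rewrite // f01.
have ball_le (u : X -> K^o) y : dual_space u -> dual_norm u <= 1 ->
    rnorm (u y) <= rnorm y.
  move=> uD u1; apply: le_trans (rnorm_dual_le y uD) _.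
  by rewrite -[leRHS]mul1r ler_wpM2r ?rnorm_ge0.
have f0E' y : f0 y = ofReal t * g y + ofReal (1 - t) * h y by rewrite {1}f0E.
have gx : rnorm (g x0) <= 1 by rewrite -x01; exact: ball_le.
have hx : rnorm (h x0) <= 1 by rewrite -x01; exact: ball_le.
have [gx0 hx0] := convex_comb_eq1 t01 gx hx (etrans (esym (f0E' x0)) f0x0).
have pairs (u : X -> K^o) : dual_space u -> dual_norm u <= 1 -> u x0 = 1 ->
    norming_pairs (x0, u).
  move=> uD u1 ux0; apply/norming_pairsP; split=> //; first exact: uD.1.
  by move=> y; exact: ball_le.
have [|gM hM] := attainment_comb t01 T_in z0max (pairs g gD g1 gx0) (pairs h hD h1 hx0).
  by move=> i; exact: f0E'.
have eq_f0 u : attainment_set p T (x0, u) -> u = f0.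
  move=> /orbit[mu [mu1 /esym uE]].
  by have [] := orbit_fixed f0x0 f0_lin uE mu1 (or_introl erefl).
by split; exact: eq_f0.
Qed.

End UniqueOrbit.

End Attainment.

(** * The differentiability criterion *)

(* At a = 0 the factor conjS a * ofReal (|a| `^ (p - 2)) is 0, since conjS 0 = 0
   and powR is total. *)
Theorem theorem4p1 (R : realType) (k : scalar_kind)
    (X : completeNormedModType (scalarField R k))
    (X_neq0 : exists x : X, x != 0)
    (w_norm : norm_on (bounded_linear X X) (num_radius X))
    (d : nat) (d_ge1 : (1 <= d)%N) (p : R) (p_gt1 : 1 < p)
    (X_findim : finite_dimensional X)
    (T : 'I_d -> X -> X) (T_in : operator_tuples T)
    (wT_neq0 : joint_radius p T <> 0) :
  (gateaux_differentiable p T <->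
   exists (x0 : X) (f0 : X -> (scalarField R k)^o), unique_attainment p T x0 f0)
  /\
  (forall (x0 : X) (f0 : X -> (scalarField R k)^o), unique_attainment p T x0 f0 ->
   forall S : 'I_d -> X -> X, operator_tuples S ->
   gateaux_derivative p T S =
   (joint_radius p T `^ (p - 1))^-1 *
   \sum_(i < d) rePart (conjS (f0 (T i x0)) *
                        ofReal (rnorm (f0 (T i x0)) `^ (p - 2)) *
                        f0 (S i x0))).
Proof.
have right_derivative x0 f0 S : unique_attainment p T x0 f0 ->
    operator_tuples S -> diff_quotient p T S t @[t --> (0 : R)^'+] -->
    radius_gradient p T S (x0, f0).
  by move=> ua S_in; exact: unique_attainment_derivative.
split; last first.
  move=> x0 f0 ua S S_in.
  by rewrite /gateaux_derivative /G_plus; exact: cvg_lim (right_derivative _ _ _ ua S_in).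
split=> [gd|[x0 [f0 ua]] S S_in]; last first.
  have [z0_in _ _ _] := ua.
  have cvg_right := right_derivative _ _ _ ua S_in.
  have cvg_left : diff_quotient p T S t @[t --> (0 : R)^'-] -->
      radius_gradient p T S (x0, f0).
    apply/diff_quotient_left; rewrite -(radius_gradientN _ _ _ z0_in).
    by apply: right_derivative ua _; exact: operator_tuplesN.
  split; [by apply/cvg_ex; eexists; exact: cvg_right
         |by apply/cvg_ex; eexists; exact: cvg_left|].
  by rewrite /G_plus /G_minus (cvg_lim _ cvg_right) ?(cvg_lim _ cvg_left).
have [[x0 f0] z0max] := attainment_nonempty p_gt1 X_findim T_in
  (joint_radius_neq0 wT_neq0).
have orbit z : attainment_set p T z ->
    exists mu, `|mu| = 1 /\ z = (mu *: x0, conjS mu *: f0).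
  move=> zmax.
  apply: (gradient_determines_pair p_gt1 X_findim wT_neq0 zmax z0max) => S S_in.
  rewrite (gateaux_gradient p_gt1 X_findim wT_neq0 T_in S_in gd zmax).
  by rewrite (gateaux_gradient p_gt1 X_findim wT_neq0 T_in S_in gd z0max).
exists x0, f0; split.
- exact: z0max.1.
- exact: orbit_extreme_point orbit.
- exact: orbit_extreme_functional orbit.
- apply/seteqP; split=> [z /orbit[mu [mu1 ->]]|_ [mu mu1 <-]]; first by exists mu.
  have [z0_in z0E] := z0max; split; first exact: norming_pair_rotate.
  have f0_lin : linear f0 := pair_linear z0_in.
  by rewrite (lp_value_rotate p x0 T_in mu1 f0_lin).
Qed.
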